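(* Let $a,b,c$ be positive real numbers such that $b^2=a(a+c)$. Then $a,b,c$ are the side lengths of a triangle if and only if either $0<c\le a$ or $0<a<c<3a$.
   Context: Triangles are non-degenerate triangles in the Euclidean plane; thus positive reals $a,b,c$ are the side lengths of a triangle exactly when the three strict inequalities $a<b+c$, $b<a+c$, $c<a+b$ hold. *)

(* Defs.v *)
From mathcomp Require Import all_boot all_order all_algebra reals.

Set Implicit Arguments.
Unset Strict Implicit.
Unset Printing Implicit Defensive.

Import Order.TTheory GRing.Theory Num.Theory.

Local Open Scope ring_scope.

(* The library norm on row vectors is the sup norm, hence an explicit
   Euclidean distance. *)
Definition eucl_dist (R : realType) (n : nat) (P Q : 'rV[R]_n) : R :=
  Num.sqrt (\sum_(i < n) (P 0 i - Q 0 i) ^+ 2).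

(* Non-degeneracy: the edge vectors issued from A are linearly independent. *)
Definition nondegenerate_triangle (R : realType) (A B C : 'rV[R]_2) : Prop :=
  row_free (col_mx (B - A) (C - A)).

Definition triangle_sides (R : realType) (a b c : R) : Prop :=
  exists A B C : 'rV[R]_2,
    [/\ nondegenerate_triangle A B C,
        eucl_dist B C = a, eucl_dist C A = b & eucl_dist A B = c].

(* Main.v *)
Require Import Defs.
From mathcomp Require Import all_boot all_order all_algebra reals.
From mathcomp Require Import ring lra.
Import Order.TTheory GRing.Theory Num.Theory.
Local Open Scope ring_scope.

(** With edge vectors u = B - A and v = C - A, Lagrange's identity
    det(u, v)^2 = |u|^2 |v|^2 - (u . v)^2 and Heron's factorisation give
    4 det(u, v)^2 = (a + b + c) (b + c - a) (a + c - b) (a + b - c),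
    so a non-degenerate triangle forces the strict triangle inequalities; the
    converse places A at the origin and B on the first axis.
    If b^2 = a (a + c), then a < b < a + c always hold, and when a < c the
    last inequality c - a < b squares to c < 3 a. *)

Lemma det_col_mx2 (R : comNzRingType) (u v : 'rV[R]_2) :
  \det (col_mx u v) = u 0 0 * v 0 1 - u 0 1 * v 0 0.
Proof.
have e01 : lift 0 0 = 1 :> 'I_2 by exact: val_inj.
have e10 : lift (1 : 'I_2) (0 : 'I_1) = 0 by exact: val_inj.
(* [col_mx] selects its block through [split]; writing each index as an [unsplit] evaluates it. *)
have s0 : split (0 : 'I_(1 + 1)) = inl 0.
  by rewrite -(unsplitK (inl 0)); congr split; exact: val_inj.
have s1 : split (1 : 'I_(1 + 1)) = inr 0.
  by rewrite -(unsplitK (inr 0)); congr split; exact: val_inj.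
rewrite (expand_det_row _ 0) !big_ord_recl big_ord0 /cofactor !det_mx11.
rewrite !mxE !e01 e10 s0 s1.
by rewrite expr0 expr1; ring.
Qed.

Lemma nondegenerate_triangleE (R : realType) (A B C : 'rV[R]_2) :
  nondegenerate_triangle A B C <->
  (B 0 0 - A 0 0) * (C 0 1 - A 0 1) != (B 0 1 - A 0 1) * (C 0 0 - A 0 0).
Proof.
rewrite /nondegenerate_triangle row_free_unit unitmxE unitfE det_col_mx2.
by rewrite !mxE subr_eq0.
Qed.

Lemma eucl_dist2 (R : realType) (P Q : 'rV[R]_2) :
  eucl_dist P Q = Num.sqrt ((P 0 0 - Q 0 0) ^+ 2 + (P 0 1 - Q 0 1) ^+ 2).
Proof.
rewrite /eucl_dist !big_ord_recl big_ord0 addr0.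
by have -> : lift ord0 ord0 = 1 :> 'I_2 by exact: val_inj.
Qed.

Lemma sqr_eucl_dist2 (R : realType) (P Q : 'rV[R]_2) :
  eucl_dist P Q ^+ 2 = (P 0 0 - Q 0 0) ^+ 2 + (P 0 1 - Q 0 1) ^+ 2.
Proof. by rewrite eucl_dist2 sqr_sqrtr // addr_ge0 ?sqr_ge0. Qed.

Lemma heron (R : realType) (A B C : 'rV[R]_2) :
  let a := eucl_dist B C in let b := eucl_dist C A in
  let c := eucl_dist A B in
  (a + b + c) * ((b + c - a) * ((a + c - b) * (a + b - c))) =
  4 * ((B 0 0 - A 0 0) * (C 0 1 - A 0 1)
       - (B 0 1 - A 0 1) * (C 0 0 - A 0 0)) ^+ 2.
Proof.
move=> a b c.
(* By the law of cosines [b ^+ 2 + c ^+ 2 - a ^+ 2] is twice the dot product of [B - A] and [C - A],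
   so what remains is Lagrange's identity. *)
have -> : (a + b + c) * ((b + c - a) * ((a + c - b) * (a + b - c))) =
  4 * b ^+ 2 * c ^+ 2 - (b ^+ 2 + c ^+ 2 - a ^+ 2) ^+ 2 by ring.
by rewrite !sqr_eucl_dist2; ring.
Qed.

(** Any two of the last three factors add up to twice a side, so at most one of them can be
    nonpositive, and then the product is nonpositive too. *)
Lemma heron_gt0 (R : realType) (a b c : R) :
  0 < a -> 0 < b -> 0 < c ->
  0 < (a + b + c) * ((b + c - a) * ((a + c - b) * (a + b - c))) <->
  [/\ a < b + c, b < a + c & c < a + b].
Proof.
move=> ha hb hc; have habc : 0 < a + b + c by lra.
rewrite pmulr_rgt0 //; split=> [h|[h1 h2 h3]]; last first.
  by rewrite !mulr_gt0 ?subr_gt0.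
have [h1|h1] := ltP a (b + c); last first.
  by move: h; rewrite pmulr_lgt0 ?mulr_gt0 //; lra.
move: h; rewrite pmulr_rgt0 ?subr_gt0 //.
have [h2|h2] := ltP b (a + c); first by rewrite pmulr_rgt0 ?subr_gt0.
by rewrite pmulr_lgt0; lra.
Qed.

Lemma triangle_sidesE (R : realType) (a b c : R) :
  0 < a -> 0 < b -> 0 < c ->
  triangle_sides a b c <-> [/\ a < b + c, b < a + c & c < a + b].
Proof.
move=> ha hb hc; rewrite -heron_gt0 //; split.
  move=> [A [B [C [/nondegenerate_triangleE hABC <- <- <-]]]].
  by rewrite heron mulr_gt0 // exprn_even_gt0 //= subr_eq0.
(* With A at the origin and B at [(c, 0)], the law of cosines forces [x] as the first coordinate of
   C. *)
move=> hS; pose x := (b ^+ 2 + c ^+ 2 - a ^+ 2) / (2 * c).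
have c0 : c != 0 by rewrite gt_eqF.
(* This is the squared height over AB. *)
have hy : 0 < b ^+ 2 - x ^+ 2.
  have -> : b ^+ 2 - x ^+ 2 =
    (a + b + c) * ((b + c - a) * ((a + c - b) * (a + b - c))) / (4 * c ^+ 2).
    by rewrite /x; field.
  by rewrite divr_gt0 // mulr_gt0 // exprn_gt0.
pose y := Num.sqrt (b ^+ 2 - x ^+ 2).
have y0 : 0 < y by rewrite sqrtr_gt0.
have hy2 : y ^+ 2 = b ^+ 2 - x ^+ 2 by rewrite sqr_sqrtr // ltW.
pose pt (s t : R) : 'rV[R]_2 := \row_i (if i == 0 then s else t).
exists 0, (pt c 0), (pt x y); split.
- apply/nondegenerate_triangleE; rewrite !mxE /= !subr0 mul0r.
  by rewrite mulf_neq0 // gt_eqF.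
- rewrite eucl_dist2 !mxE /= sub0r sqrrN hy2.
  have -> : (c - x) ^+ 2 + (b ^+ 2 - x ^+ 2) = a ^+ 2 by rewrite /x; field.
  by rewrite sqrtr_sqr gtr0_norm.
- rewrite eucl_dist2 !mxE /= !subr0 hy2 addrC subrK.
  by rewrite sqrtr_sqr gtr0_norm.
- rewrite eucl_dist2 !mxE /= !sub0r oppr0 expr0n /= addr0 sqrrN.
  by rewrite sqrtr_sqr gtr0_norm.
Qed.

Theorem lemma2 (R : realType) (a b c : R)
    (ha : 0 < a) (hb : 0 < b) (hc : 0 < c)
    (habc : b ^+ 2 = a * (a + c)) :
  triangle_sides a b c <->
  (0 < c <= a) \/ [/\ 0 < a, a < c & c < 3 * a].
Proof.
rewrite triangle_sidesE //.
(* Here [b ^+ 2 - a ^+ 2 = a * c] and [(a + c) ^+ 2 - b ^+ 2 = c * (a + c)], both positive. *)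
have hab : a < b by nra.
have hbac : b < a + c by nra.
split=> [[_ _ h]|h].
  have [hca|hac] := leP c a; first by left; rewrite hc.
  (* Squaring [c - a < b] gives [c ^+ 2 < 3 * a * c]. *)
  by right; split=> //; nra.
split=> //; first by lra.
by case: h => [/andP[_ hca]|[_ hac h]]; [lra|nra].
Qed.
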